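(* Let $c$, $d$ be positive integers, let $k\ge 2$, and let $n_1\leq n_2\leq\dots\leq n_k$ be even positive integers. Then $2k<\chi_{ld}(B_{c,d}[K_{n_1,n_2,\dots,n_k}])\leq 3k$.
   Context: All graphs are finite, simple and undirected. For a graph $G$ of order $n$ and a bijection $f\colon V(G)\to\{1,2,\dots,n\}$, the weight of a vertex $u$ is $w_f(u)=\sum_{x\in N(u)}f(x)$, where $N(u)$ is the open neighborhood of $u$. The bijection $f$ is a local distance antimagic labeling of $G$ if $w_f(u)\neq w_f(v)$ for every edge $uv$ of $G$. The local distance antimagic chromatic number $\chi_{ld}(G)$ is the minimum number of distinct weights over all local distance antimagic labelings of $G$ (an upper bound on $\chi_{ld}$ includes the assertion that such a labeling exists). The double star $B_{c,d}$ is obtained from $K_2$ by joining $c$ pendant edges to one end and $d$ pendant edges to the other end. $K_{n_1,\dots,n_k}$ is the complete multipartite graph with parts of sizes $n_1,\dots,n_k$. The lexicographic product (composition) $G[H]$ has vertex set $V(G)\times V(H)$, with $(g,h)$ and $(g',h')$ adjacent iff either $gg'\in E(G)$, or $g=g'$ and $hh'\in E(H)$. *)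

(* Defs.v *)
From mathcomp Require Import all_boot.

Set Implicit Arguments.
Unset Strict Implicit.
Unset Printing Implicit Defensive.

Record sgraph := SGraph {
  vertex :> finType;
  adj : rel vertex;
  adj_sym : symmetric adj;
  adj_irr : irreflexive adj
}.

(* A labeling V(G) -> {1, ..., n} is encoded as f : G -> 'I_n with n = #|G|,
   the label of x being (f x).+1. *)
Definition weight (G : sgraph) (f : G -> 'I_#|G|) (u : G) : nat :=
  \sum_(x : G | adj u x) (f x).+1.

Definition local_distance_antimagic (G : sgraph) (f : G -> 'I_#|G|) : Prop :=
  bijective f /\ forall u v : G, adj u v -> weight f u != weight f v.

Definition num_weights (G : sgraph) (f : G -> 'I_#|G|) : nat :=
  size (undup [seq weight f u | u : G]).

(* chi_ld(G) is undefined when G has no local distance antimagic labeling, so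
   it is given by its graph: "chi_ld(G) exists and equals m". *)
Definition is_chi_ld (G : sgraph) (m : nat) : Prop :=
  (exists2 f : G -> 'I_#|G|, local_distance_antimagic f & num_weights f = m) /\
  (forall f : G -> 'I_#|G|, local_distance_antimagic f -> m <= num_weights f).

Lemma is_chi_ld_unique (G : sgraph) (m p : nat) :
  is_chi_ld G m -> is_chi_ld G p -> m = p.
Proof.
move=> [[f hf <-] minm] [[g hg <-] minp].
by apply/eqP; rewrite eqn_leq minm // minp.
Qed.

(* inl false and inl true are the ends of K_2; inr (inl _) are the c pendant
   vertices at inl false, inr (inr _) the d pendant vertices at inl true. *)
Definition double_star_adj (c d : nat) : rel (bool + ('I_c + 'I_d)) :=
  fun u v => match u, v with
  | inl a, inl b => a != b
  | inl a, inr (inl _) | inr (inl _), inl a => ~~ a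
  | inl a, inr (inr _) | inr (inr _), inl a => a
  | inr _, inr _ => false
  end.

Lemma double_star_sym (c d : nat) : symmetric (@double_star_adj c d).
Proof. by move=> [a|[i|i]] [b|[j|j]] //=; rewrite eq_sym. Qed.

Lemma double_star_irr (c d : nat) : irreflexive (@double_star_adj c d).
Proof. by move=> [a|[i|i]] //=; rewrite eqxx. Qed.

Definition double_star (c d : nat) : sgraph :=
  SGraph (@double_star_sym c d) (@double_star_irr c d).

Definition multipartite_adj (k : nat) (n : 'I_k -> nat) :
  rel {i : 'I_k & 'I_(n i)} := fun u v => tag u != tag v.

Lemma multipartite_sym (k : nat) (n : 'I_k -> nat) :
  symmetric (@multipartite_adj k n).
Proof. by move=> u v; rewrite /multipartite_adj eq_sym. Qed.

Lemma multipartite_irr (k : nat) (n : 'I_k -> nat) :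
  irreflexive (@multipartite_adj k n).
Proof. by move=> u; rewrite /multipartite_adj eqxx. Qed.

Definition complete_multipartite (k : nat) (n : 'I_k -> nat) : sgraph :=
  SGraph (@multipartite_sym k n) (@multipartite_irr k n).

Definition lex_adj (G H : sgraph) : rel (G * H) :=
  fun u v => adj u.1 v.1 || (u.1 == v.1) && adj u.2 v.2.

Lemma lex_sym (G H : sgraph) : symmetric (@lex_adj G H).
Proof. by move=> u v; rewrite /lex_adj adj_sym eq_sym (adj_sym u.2). Qed.

Lemma lex_irr (G H : sgraph) : irreflexive (@lex_adj G H).
Proof. by move=> u; rewrite /lex_adj !adj_irr andbF. Qed.

Definition lex_product (G H : sgraph) : sgraph :=
  SGraph (@lex_sym G H) (@lex_irr G H).

(* Main.v *)
(* Lower bound.  Let x, y be the centres of the double star, p a leaf at x and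
   q a leaf at y.  Inside a copy of K the weight depends only on the part, and
   each copy shows k distinct weights, so x and y already show 2k.  With
   exactly 2k, p shows the weights of y and q those of x.  Comparing the sums
   of these weights, with S(g) the label sum of copy g, gives
     (k-1) S(p) >= (k-1) S(y) + k S(q)  and  (k-1) S(q) >= (k-1) S(x) + k S(p),
   which is impossible.

   Upper bound.  It suffices that all leaf copies have the same part sums Q_i,
   and that the part sums X_i of x and Y_i of y are 2k distinct numbers with
   sum X_i = sum Y_i < sum Q_i: then all leaves show the same k weights.  Group
   the positions of K into consecutive pairs, the levels, none of which
   straddles two parts as the n_i are even.  The leaves share the large labels,
   each level consisting of pairs of constant sum; x and y share the small ones,
   four per level, normally split as {0,3}, {1,2}.  At the first level of part i
   the split is perturbed so as to move X_i and Y_i in opposite directions by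
   1 or 2, with total displacement 0; monotonicity of the n_i keeps different
   parts far enough apart. *)

Require Import Defs.
From mathcomp Require Import all_boot.
From mathcomp Require Import zify.

Set Implicit Arguments.
Unset Strict Implicit.
Unset Printing Implicit Defensive.

(** Labelings, taken as finite functions, form a finite type on which being antimagic is decidable,
    so a minimizer can be picked. *)
Lemma is_chi_ld_exists (G : sgraph) (f : G -> 'I_#|G|) :
  local_distance_antimagic f -> exists2 m, is_chi_ld G m & m <= num_weights f.
Proof.
pose antimagic (g : {ffun G -> 'I_#|G|}) :=
  injectiveb g && [forall u : G, forall v : G, adj u v ==> (weight g u != weight g v)].
have weight_finfun (g : G -> 'I_#|G|) u : weight (finfun g) u = weight g u.
  by apply: eq_bigr => x _; rewrite ffunE.
have num_finfun (g : G -> 'I_#|G|) : num_weights (finfun g) = num_weights g.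
  by rewrite /num_weights; congr (size (undup _)); apply: eq_map => u.
have antimagicP (g : G -> 'I_#|G|) :
    local_distance_antimagic g -> antimagic (finfun g).
  move=> [/bij_inj g_inj g_adj]; apply/andP; split.
    by apply/injectiveP=> u v; rewrite !ffunE => /g_inj.
  apply/forallP=> u; apply/forallP=> v; apply/implyP=> uv.
  by rewrite !weight_finfun g_adj.
move=> /antimagicP f_ok.
case: (arg_minnP (fun g : {ffun G -> 'I_#|G|} => num_weights g) f_ok) => g g_ok g_min.
exists (num_weights g); last by rewrite -(num_finfun f); exact: g_min.
split=> [|f' /antimagicP f'_ok]; last by rewrite -(num_finfun f'); exact: g_min.
exists g => //; case/andP: g_ok => /injectiveP g_inj /forallP g_adj.
split=> [|u v uv]; first by apply: inj_card_bij; rewrite ?card_ord.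
by move/forallP: (g_adj u) => /(_ v) /implyP; apply.
Qed.

(** * Weights in a lexicographic product with a complete multipartite graph *)

Section LexMultipartite.

Variables (G : sgraph) (k : nat) (n : 'I_k -> nat).
Notation H := (complete_multipartite n).
Notation GH := (lex_product G H).

Definition lex_vertex (g : G) (i : 'I_k) (a : 'I_(n i)) : GH :=
  (g, Tagged (fun i => 'I_(n i)) a).

Variable f : GH -> 'I_#|GH|.

Definition part_sum (g : G) (i : 'I_k) : nat :=
  \sum_(a < n i) (f (lex_vertex g a)).+1.

Definition copy_sum (g : G) : nat := \sum_i part_sum g i.

Definition part_weight (g : G) (i : 'I_k) : nat :=
  \sum_(g' | adj g g') copy_sum g' + \sum_(j | j != i) part_sum g j.

Lemma weight_lex (u : GH) : weight f u = part_weight u.1 (tag u.2).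
Proof.
case: u => g [i a] /=.
have sumH (P : pred 'I_k) g' :
    \sum_(v : H | P (tag v)) (f (g', v)).+1 = \sum_(j | P j) part_sum g' j.
  rewrite /part_sum (sig_big_dep P (fun _ => xpredT)
    (fun j (b : 'I_(n j)) => (f (lex_vertex g' b)).+1)).
  apply: eq_big => [v|[j b] _] //=; by rewrite andbT.
rewrite /part_weight -sumH /weight.
transitivity (\sum_(g' : G) \sum_(v : H | adj g g' || (g == g') && (i != tag v))
    (f (g', v)).+1).
  by rewrite pair_big_dep /=; apply: eq_bigr => [[]].
(* Copies at neighbours of [g] contribute fully; among the others only copy [g] itself contributes,
   through its parts other than [i]. *)
rewrite (bigID (adj g)) /=; congr (_ + _).
  apply: eq_bigr => g' gg'; rewrite /copy_sum -sumH.
  by apply: eq_bigl => v; rewrite gg'.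
rewrite (bigD1 g) ?adj_irr //= [X in _ + X]big1 => [|g' /andP[gg' g'g]].
  by rewrite addn0; apply: eq_bigl => v; rewrite eqxx eq_sym.
by rewrite big1 // => v; rewrite (negPf gg') eq_sym (negPf g'g).
Qed.

(** Adding back the missing part gives a total independent of [i]: within a copy, equal weights mean
    equal part sums. *)
Lemma part_weightD (g : G) (i : 'I_k) :
  part_weight g i + part_sum g i =
  \sum_(g' | adj g g') copy_sum g' + copy_sum g.
Proof.
rewrite -addnA; congr (_ + _).
by rewrite /copy_sum [RHS](bigD1 i) //= addnC.
Qed.

Lemma sum_part_weight (g : G) :
  \sum_i part_weight g i + copy_sum g =
  k * (\sum_(g' | adj g g') copy_sum g' + copy_sum g).
Proof.
rewrite /copy_sum -big_split /=.
under eq_bigr do rewrite part_weightD.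
by rewrite sum_nat_const card_ord.
Qed.

Lemma part_sum_gt0 g i : 0 < n i -> 0 < part_sum g i.
Proof.
by move=> ni; rewrite /part_sum (bigD1 (Ordinal ni)).
Qed.

End LexMultipartite.

(** * Lower bound, and a sufficient criterion for the upper bound *)

Section DoubleStar.

Variables (c d k : nat) (n : 'I_k -> nat).
Hypothesis (n_pos : forall i, 0 < n i).
Notation B := (double_star c d).
Notation GH := (lex_product B (complete_multipartite n)).
Variable f : GH -> 'I_#|GH|.

Lemma sum_adj_center (b : bool) (F : B -> nat) :
  \sum_(g : B | adj (inl b : B) g) F g = F (inl (~~ b)) +
  if b then \sum_j F (inr (inr j)) else \sum_i F (inr (inl i)).
Proof.
rewrite !big_sumType /=.
case: b.
  rewrite (big_pred1 false) => [|[]] //=.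
  by rewrite big_pred0_eq add0n.
rewrite (big_pred1 true) => [|[]] //=.
by rewrite big_pred0_eq addn0.
Qed.

Lemma sum_adj_leaf (s : 'I_c + 'I_d) (F : B -> nat) :
  \sum_(g : B | adj (inr s : B) g) F g =
  F (inl (if s is inr _ then true else false)).
Proof.
rewrite !big_sumType /=.
by case: s => s; rewrite !big_pred0_eq !addn0;
  [rewrite (big_pred1 false) | rewrite (big_pred1 true)] => //; case.
Qed.

Lemma num_weights_lower : 0 < c -> 0 < d -> 2 <= k ->
  local_distance_antimagic f -> 2 * k < num_weights f.
Proof.
move=> hc hd hk [_ f_adj].
pose W (g : B) := [seq part_weight f g i | i <- enum 'I_k].
pose vtx g i : GH := lex_vertex g (Ordinal (n_pos i)).
pose U := undup [seq weight f u | u : GH].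
have sizeW g : size (W g) = k by rewrite size_map size_enum_ord.
have subU g : {subset W g <= U}.
  move=> w /mapP[i _ ->]; rewrite mem_undup.
  by apply/mapP; exists (vtx g i); rewrite ?mem_enum // weight_lex.
have W_adj g g' w : adj g g' -> w \in W g -> w \in W g' -> False.
  move=> gg' /mapP[i _ ->] /mapP[j _] eq_w.
  have /f_adj/eqP[] : adj (vtx g i) (vtx g' j) by rewrite /= /lex_adj gg'.
  by rewrite !weight_lex.
have uniqW g : uniq (W g).
  rewrite map_inj_in_uniq ?enum_uniq // => i j _ _ eq_w.
  apply/eqP/negPn/negP => ij.
  have /f_adj/eqP[] : adj (vtx g i) (vtx g j).
    by rewrite /= /lex_adj eqxx /= [X in _ || X]ij orbT.
  by rewrite !weight_lex.
rewrite ltnNge /num_weights -/U; apply/negP => sizeU.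
(* The disjoint weight sets of [g] and [g'] already fill [U]; that of [h] avoids the one of [g], so
   it lies in that of [g'], and both have size [k]. *)
have sum_weight_eq g g' h : adj g g' -> adj g h ->
    \sum_i part_weight f g' i = \sum_i part_weight f h i.
  move=> gg' gh.
  have uniq2 : uniq (W g ++ W g').
    rewrite cat_uniq !uniqW andbT /=; apply/hasPn => w wg'.
    by apply/negP => /(W_adj _ _ _ gg'); apply.
  have sub2 : {subset W g ++ W g' <= U}.
    by move=> w; rewrite mem_cat => /orP[] /subU.
  have [_ eqU] : (size (W g ++ W g') = size U) * (W g ++ W g' =i U).
    by apply: uniq_min_size => //; rewrite size_cat !sizeW addnn -mul2n.
  have sub_hg' : {subset W h <= W g'}.
    move=> w wh; have := subU _ _ wh; rewrite -eqU mem_cat => /orP[] // wg.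
    by case: (W_adj _ _ _ gh wg wh).
  have [_ eqW] : (size (W h) = size (W g')) * (W h =i W g').
    by apply: uniq_min_size => //; rewrite !sizeW.
  have /perm_sumn : perm_eq (W g') (W h).
    by apply: uniq_perm => // w; rewrite eqW.
  by rewrite !sumnE !big_map -!enumT !big_enum.
have sum0 := sum_part_weight f (inl false).
have sum1 := sum_part_weight f (inl true).
have sump := sum_part_weight f (inr (inl (Ordinal hc))).
have sumq := sum_part_weight f (inr (inr (Ordinal hd))).
have eq0 := sum_weight_eq (inl false) (inl true) (inr (inl (Ordinal hc))) isT isT.
have eq1 := sum_weight_eq (inl true) (inl false) (inr (inr (Ordinal hd))) isT isT.
move: sum0 sum1 sump sumq; rewrite !sum_adj_center !sum_adj_leaf {}eq0 {}eq1 /=.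
(* The two inequalities add up to S(p) + S(q) <= 0, which positivity of S(p) refutes. *)
have p_pos : 0 < copy_sum f (inr (inl (Ordinal hc))).
  have k_gt0 : 0 < k by apply: ltnW.
  by rewrite /copy_sum (bigD1 (Ordinal k_gt0)) //= ltn_addr ?part_sum_gt0.
rewrite (bigD1 (Ordinal hc)) // (bigD1 (Ordinal hd)) //=.
move: (copy_sum _ _) (copy_sum _ _) (copy_sum _ _) (copy_sum _ _) p_pos.
nia.
Qed.

Lemma local_distance_antimagic_double_star (X Y Q : 'I_k -> nat) :
  0 < c -> 0 < d -> injective f ->
  part_sum f (inl false) =1 X -> part_sum f (inl true) =1 Y ->
  (forall s, part_sum f (inr s) =1 Q) ->
  injective X -> injective Y -> injective Q -> (forall i j, X i <> Y j) ->
  \sum_i X i = \sum_i Y i -> \sum_i X i < \sum_i Q i ->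
  local_distance_antimagic f /\ num_weights f <= 3 * k.
Proof.
move=> hc hd f_inj fX fY fQ X_inj Y_inj Q_inj XY sumXY sumXQ.
have copyX : copy_sum f (inl false) = \sum_i X i by apply: eq_bigr.
have copyY : copy_sum f (inl true) = \sum_i X i by rewrite sumXY; apply: eq_bigr.
have copyQ s : copy_sum f (inr s) = \sum_i Q i by apply: eq_bigr => i _; exact: fQ.
have leX i : X i <= \sum_i X i by rewrite (bigD1 i) ?leq_addr.
have leY i : Y i <= \sum_i X i by rewrite sumXY (bigD1 i) ?leq_addr.
have Q_gt0 i : 0 < Q i by rewrite -(fQ (inl (Ordinal hc))) part_sum_gt0.
pose wX := part_weight f (inl false); pose wY := part_weight f (inl true).
have wXE i : wX i + X i = \sum_i X i + c * \sum_i Q i + \sum_i X i.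
  rewrite -fX [LHS]part_weightD sum_adj_center copyX copyY /=.
  by under [X in _ + X + _]eq_bigr do rewrite copyQ; rewrite sum_nat_const card_ord.
have wYE i : wY i + Y i = \sum_i X i + d * \sum_i Q i + \sum_i X i.
  rewrite -fY [LHS]part_weightD sum_adj_center copyX copyY /=.
  by under [X in _ + X + _]eq_bigr do rewrite copyQ; rewrite sum_nat_const card_ord.
have wQE s i : part_weight f (inr s) i + Q i = \sum_i X i + \sum_i Q i.
  rewrite -(fQ s) part_weightD sum_adj_leaf copyQ.
  by case: s => s; rewrite ?copyX ?copyY.
move: (\sum_i X i) (\sum_i Q i) sumXQ leX leY wXE wYE wQE.
move=> A S AS leX leY wXE wYE wQE {copyX copyY copyQ sumXY}.
(* A centre weight is at least [A + S], whereas a leaf weight is [A + S - Q j] with [Q j]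
   positive. *)
have wXQ i j s : wX i <> part_weight f (inr s) j.
  by move: (wXE i) (wQE s j) (leX i) (Q_gt0 j); nia.
have wYQ i j s : wY i <> part_weight f (inr s) j.
  by move: (wYE i) (wQE s j) (leY i) (Q_gt0 j); nia.
have wXY i j : wX i <> wY j.
  move: (wXE i) (wYE j) (leX i) (leY j) (XY i j) => wXi wYj leXi leYj XYij.
  (* If [c = d] the weights differ because [X i] and [Y j] do; otherwise [c * S] and [d * S] are at
     least [S] apart, more than [A], which bounds [X i] and [Y j]. *)
  by case: (ltngtP c d) => cd; nia.
split; first split; first by apply: inj_card_bij => //; rewrite card_ord.
  move=> [g [i a]] [g' [j b]]; rewrite !weight_lex /= /lex_adj /=.
  case: eqVneq => [<-|_] /=.
    rewrite double_star_irr /= => /eqP ij; apply/eqP => eq_w; apply: ij.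
    case: g eq_w => [[]|s] eq_w.
    - by apply: Y_inj; apply: (@addnI (wY i)); rewrite wYE [wY i]eq_w -/wY wYE.
    - by apply: X_inj; apply: (@addnI (wX i)); rewrite wXE [wX i]eq_w -/wX wXE.
    - by apply: Q_inj; apply: (@addnI (part_weight f (inr s) i)); rewrite wQE eq_w wQE.
  case: g g' => [[]|s] [[]|s'] //= gg'; apply/eqP.
  - by move/esym/wXY.
  - exact: wYQ.
  - exact: wXY.
  - exact: wXQ.
  - by move/esym/wYQ.
  - by move/esym/wXQ.
  - by case: s gg'.
pose leaf : B := inr (inl (Ordinal hc)).
pose W := [seq wX i | i <- enum 'I_k] ++ [seq wY i | i <- enum 'I_k] ++
          [seq part_weight f leaf i | i <- enum 'I_k].
have <- : size W = 3 * k by rewrite /W !size_cat !size_map -!enumT size_enum_ord; lia.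
apply: uniq_leq_size; first exact: undup_uniq.
move=> w; rewrite mem_undup => /mapP[[g [i a]] _ ->]; rewrite weight_lex /=.
rewrite !mem_cat.
have w_in (F : 'I_k -> nat) : F i \in [seq F j | j <- enum 'I_k].
  by rewrite map_f ?mem_enum.
case: g => [[]|s].
- by rewrite (w_in wY) orbT.
- by rewrite (w_in wX).
- have -> : part_weight f (inr s) i = part_weight f leaf i.
    by apply: (@addIn (Q i)); rewrite !wQE.
  by rewrite w_in !orbT.
Qed.

End DoubleStar.

(** * Levels: consecutive pairs of positions, numbered across the parts *)

Lemma sum_even_split (m : nat) (F : nat -> nat) : ~~ odd m ->
  \sum_(a < m) F a = \sum_(l < m./2) (F l.*2 + F l.*2.+1).
Proof.
move=> m_even; rewrite -[in LHS](even_halfK m_even); elim: (m./2) => [|h IHh].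
  by rewrite double0 !big_ord0.
by rewrite doubleS !big_ord_recr /= IHh addnA.
Qed.

Section Levels.

Variables (k : nat) (n : 'I_k -> nat).

(** The position [a] is a plain number so that [level i (n i)] makes sense: it is the first level
    after part [i]. *)
Definition level (i : 'I_k) (a : nat) : nat := \sum_(j < k | j < i) (n j)./2 + a./2.

Lemma level_half_lt (i j : 'I_k) (a : nat) : i < j -> level i (n i) + a./2 <= level j a.
Proof.
move=> ij; rewrite /level leq_add2r [X in _ <= X](bigD1 i) //= addnC leq_add2l.
rewrite big_mkcond [X in _ <= X]big_mkcond; apply: leq_sum => l _.
case: ifP => //; case: ifP => //; rewrite -val_eqE /=; lia.
Qed.

Lemma level_half_sum (i : 'I_k) : level i (n i) <= \sum_i (n i)./2.
Proof.
rewrite /level [X in _ <= X](bigD1 i) //= addnC leq_add2l.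
rewrite big_mkcond [X in _ <= X]big_mkcond; apply: leq_sum => l _.
case: ifP => //; case: ifP => //; rewrite -val_eqE /=; lia.
Qed.

Hypothesis n_even : forall i, ~~ odd (n i).

Lemma level_lt (i : 'I_k) (a : 'I_(n i)) : level i a < \sum_i (n i)./2.
Proof.
move: (level_half_sum i) (n_even i) (ltn_ord a); rewrite /level.
by move: (\sum_(j < k | _) _) (\sum_i _); lia.
Qed.

Lemma level_inj (i j : 'I_k) (a : 'I_(n i)) (b : 'I_(n j)) :
  level i a = level j b -> i = j /\ a./2 = b./2.
Proof.
have lt_level (i' j' : 'I_k) (a' : 'I_(n i')) (b' : 'I_(n j')) :
    i' < j' -> level i' a' < level j' b'.
  move=> /(level_half_lt b'); move: (n_even i') (ltn_ord a'); rewrite /level.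
  by move: (\sum_(_ < k | _) _) (\sum_(_ < k | _) _); lia.
case: (ltngtP i j) => [/(lt_level _ _ a b)|/(lt_level _ _ b a)|/val_inj ij].
- lia.
- lia.
by case: _ / ij b => b /addnI.
Qed.

End Levels.

(* quad e y false and quad e y true are the two labels, within a level, of the
   centre y; those of the centre false add up to e, those of true to 6 - e. *)
Definition quad (e : nat) (y b : bool) : nat :=
  nth 0 (match e with
         | 1 => [:: 0; 1; 2; 3]
         | 2 => [:: 0; 2; 1; 3]
         | 4 => [:: 1; 3; 0; 2]
         | _ => [:: 0; 3; 1; 2]
         end) (y.*2 + b).

Lemma quad_lt e y b : quad e y b < 4.
Proof. by case: e => [|[|[|[|[|e]]]]]; case: y b => [] []. Qed.

Lemma quad_inj e y b y' b' : quad e y b = quad e y' b' -> y = y' /\ b = b'.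
Proof. by case: e => [|[|[|[|[|e]]]]]; case: y b y' b' => [] [] [] []. Qed.

(* For odd k the signs cannot cancel in pairs, so the first three parts are
   displaced by +1, +1, -2 relative to the neutral value 3. *)
Definition shift (k i : nat) : nat :=
  if odd k && (i < 3) then nth 0 [:: 4; 4; 1] i else if odd i then 2 else 4.

Lemma shift_mem k i : shift k i \in [:: 1; 2; 4].
Proof.
by rewrite /shift; case: (odd k) i => [] [|[|[|i]]] //=; case: odd.
Qed.

Lemma quad_sum k i y :
  quad (shift k i) y false + quad (shift k i) y true = if y then 6 - shift k i else shift k i.
Proof. by have := shift_mem k i; rewrite !inE => /or3P[] /eqP ->; case: y. Qed.

Lemma sum_shift k : 2 <= k -> \sum_(i < k) shift k i = 3 * k.
Proof.
case k_odd: (odd k) => hk; rewrite /shift k_odd /=.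
  (* The first three parts contribute 4 + 4 + 1 = 9, and each later pair 2 + 4 = 6. *)
  have {hk k_odd} -> : k = (k - 3)./2.*2 + 3 by lia.
  elim: (k - 3)./2 => [|m IHm]; first by rewrite !big_ord_recr big_ord0.
  rewrite doubleS !addSn !big_ord_recr /= IHm.
  have -> : odd (m.*2 + 3) = true by lia.
  by case: ifP; case: ifP; lia.
have {hk k_odd} -> : k = k./2.*2 by lia.
elim: k./2 => [|m IHm]; first by rewrite big_ord0.
by rewrite doubleS !big_ord_recr /= IHm odd_double /=; lia.
Qed.

Lemma leq_sum_ord (p q : nat) (F F' : nat -> nat) : p <= q ->
  (forall l, l < p -> F l <= F' l) -> \sum_(l < p) F l <= \sum_(l < q) F' l.
Proof.
move=> pq FF'; rewrite -(subnKC pq) big_split_ord /=.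
by apply: leq_trans (leq_addr _ _); apply: leq_sum => l _; apply: FF'.
Qed.

(** * The explicit labeling and its part sums *)

Section Labeling.

Variables (c d k : nat) (n : 'I_k -> nat).
Notation B := (double_star c d).
Notation GH := (lex_product B (complete_multipartite n)).
Notation L := (\sum_i (n i)./2).

(** The two offsets of a leaf mirror each other, so their sum is the same for every leaf. *)
Definition leaf_offset (s : 'I_c + 'I_d) (b : bool) : nat :=
  if b then (2 * (c + d)).-1 - unsplit s else unsplit s.

(** Labels start at 0 here. The argument 3 selects the default, unperturbed split of [quad]; it is
    never a value of [shift]. *)
Definition label_at (g : B) (i : 'I_k) (a : nat) : nat :=
  match g with
  | inl y => 4 * level n i a + quad (if a./2 == 0 then shift k i else 3) y (odd a)
  | inr s => 4 * L + (2 * (c + d) * level n i a + leaf_offset s (odd a))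
  end.

Definition label (u : GH) : nat := label_at u.1 (tag u.2) (tagged u.2).

Lemma leaf_offset_lt s b : leaf_offset s b < 2 * (c + d).
Proof. by rewrite /leaf_offset; have := ltn_ord (unsplit s); case: b; lia. Qed.

Lemma leaf_offset_inj s s' b b' :
  leaf_offset s b = leaf_offset s' b' -> s = s' /\ b = b'.
Proof.
rewrite /leaf_offset; have := ltn_ord (unsplit s); have := ltn_ord (unsplit s').
move=> ltT ltT' eq_off.
have [eq_s ->] : unsplit s = unsplit s' :> nat /\ b = b'.
  by move: eq_off; case: b b' => [] [] /=; lia.
by split=> //; apply: (can_inj unsplitK); apply: val_inj.
Qed.

Hypothesis n_even : forall i, ~~ odd (n i).

Lemma card_lex_double_star : #|GH| = 4 * L + 2 * (c + d) * L.
Proof.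
rewrite card_prod !card_sum card_bool !card_ord card_tagged sumnE big_map big_enum /=.
under eq_bigr do rewrite card_ord -(even_halfK (n_even _)) -mul2n.
rewrite -big_distrr /=; under eq_bigl do rewrite inE; move: (L) => l; lia.
Qed.

Lemma label_lt u : label u < #|GH|.
Proof.
case: u => g [i a]; rewrite card_lex_double_star /label /=.
have muln_lt m q r : r < m -> q < L -> m * q + r < m * L.
  move=> rm qL; apply: leq_trans (_ : m * q.+1 <= _); last by rewrite leq_mul2l qL orbT.
  by rewrite mulnS addnC ltn_add2r.
case: g => [y|s] /=; last by rewrite ltn_add2l muln_lt ?leaf_offset_lt ?level_lt.
by rewrite ltn_addr // muln_lt ?quad_lt ?level_lt.
Qed.

(** Centre labels stay below [4 * L]. Inside each block, division by 4 or by [2 * (c + d)] recovers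
    the level, and the remainder gives the vertex of the star and the parity. *)
Lemma label_inj : injective label.
Proof.
have divmod_inj m q q' r r' : r < m -> r' < m -> m * q + r = m * q' + r' ->
    q = q' /\ r = r'.
  move=> rm r'm eq_qr; have m_gt0 : 0 < m by apply: leq_ltn_trans rm.
  have := congr1 (modn^~ m) eq_qr; have := congr1 (divn^~ m) eq_qr.
  by rewrite /= !(mulnC m) !divnMDl // !modnMDl !divn_small // !modn_small // !addn0.
have center_lt y (i : 'I_k) (a : 'I_(n i)) : label_at (inl y) i a < 4 * L.
  have := level_lt n_even a; rewrite /label_at.
  move: (quad_lt (if (a : nat)./2 == 0 then shift k i else 3) y (odd a)).
  by move: (quad _ _ _) (level _ _ _) (L); lia.
case=> [g [i a]] [g' [j b]]; rewrite /label /= => eq_label.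
suff [eq_g [eq_level eq_odd]] :
    g = g' /\ level n i a = level n j b /\ odd a = odd b.
  have [ij eq_half] := level_inj n_even eq_level.
  case: _ / ij b eq_level eq_odd eq_half {eq_label} => b _ eq_odd eq_half.
  rewrite eq_g; congr (_, Tagged _ _); apply: val_inj => /=.
  by rewrite -[a : nat]odd_double_half eq_odd eq_half odd_double_half.
case: g g' eq_label => [y|s] [y'|s'] eq_label.
- have [eq_level eq_quad] := divmod_inj _ _ _ _ _ (quad_lt _ _ _) (quad_lt _ _ _) eq_label.
  (* The split depends on the part and on whether the level is its first, so both must be matched
     before [quad_inj] applies. *)
  have [ij eq_half] := level_inj n_even eq_level.
  have eq_shift : shift k i = shift k j by rewrite ij.
  by move: eq_quad; rewrite eq_half eq_shift => /quad_inj[-> ->].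
- by have := center_lt y i a; rewrite eq_label /=; lia.
- by have := center_lt y' j b; rewrite -eq_label /=; lia.
move/addnI: eq_label.
move/(divmod_inj _ _ _ _ _ (leaf_offset_lt _ _) (leaf_offset_lt _ _)).
by move=> [-> /leaf_offset_inj[-> ->]].
Qed.

Definition labeling (u : GH) : 'I_#|GH| := Ordinal (label_lt u).

Lemma labeling_inj : injective labeling.
Proof. by move=> u v /(congr1 val) /label_inj. Qed.

(** The value with every level unperturbed: 5 is the offset sum 3 plus 1 for each of the two
    labels. *)
Definition center_base (i : 'I_k) : nat :=
  \sum_(l < (n i)./2) (8 * level n i l.*2 + 5).

Definition center_shift (y : bool) (i : 'I_k) : nat :=
  if y then 6 - shift k i else shift k i.

(** The first level trades its neutral 3 for the shift; for nonempty parts [center_base] is at least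
    5, so the subtraction does not truncate. *)
Definition center_part (y : bool) (i : 'I_k) : nat :=
  center_base i + center_shift y i - 3.

Definition leaf_part (i : 'I_k) : nat :=
  \sum_(l < (n i)./2) (8 * L + 2 * (c + d) * (level n i l.*2).*2 + (2 * (c + d)).+1).

Lemma part_sum_split (g : B) i : part_sum labeling g i =
  \sum_(l < (n i)./2) ((label_at g i l.*2).+1 + (label_at g i l.*2.+1).+1).
Proof.
by rewrite -(sum_even_split (fun a => (label_at g i a).+1)).
Qed.

Lemma level_doubleS i l : level n i l.*2.+1 = level n i l.*2.
Proof. by rewrite /level -[l.*2.+1]/(true + l.*2) half_bit_double half_double. Qed.

Hypothesis n_pos : forall i, 0 < n i.

Lemma half_gt0 i : 0 < (n i)./2.
Proof. by move: (n_pos i) (n_even i); lia. Qed.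

Lemma part_sum_center y i :
  part_sum labeling (inl y) i = center_part y i.
Proof.
apply: (@addIn 3); rewrite /center_part subnK; last first.
  rewrite /center_base; move: (half_gt0 i); case: (_./2) => // h _.
  by rewrite big_ord_recl; lia.
rewrite part_sum_split /center_base; move: (half_gt0 i); case: (_./2) => // h _.
rewrite !big_ord_recl /= level_doubleS.
have quad3 : quad 3 y false + quad 3 y true = 3 by case: y.
rewrite (eq_bigr (fun l : 'I_h => 8 * level n i (bump 0 l).*2 + 5)) => [|l _].
  by have := quad_sum k i y; rewrite /center_shift; lia.
by rewrite level_doubleS odd_double /=; lia.
Qed.

Lemma part_sum_leaf s i : part_sum labeling (inr s) i = leaf_part i.
Proof.
rewrite part_sum_split; apply: eq_bigr => l _ /=.
rewrite level_doubleS odd_double /leaf_offset /=.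
by have := ltn_ord (unsplit s); lia.
Qed.

(** * Separation and balance of the part sums *)

Hypothesis n_mono : forall i j : 'I_k, i <= j -> n i <= n j.

Lemma half_mono (i j : 'I_k) : i <= j -> (n i)./2 <= (n j)./2.
Proof. by move=> /n_mono; exact: half_leq. Qed.

Lemma level_double_lt (i j : 'I_k) l : i < j -> level n i l.*2 < level n j l.*2.
Proof.
move=> /(level_half_lt n l.*2); move: (half_gt0 i); rewrite /level.
by move: (\sum_(_ < k | _) _) (\sum_(_ < k | _) _); lia.
Qed.

(** Part [j] has at least as many levels as part [i], each with a larger number and hence worth 8
    more. The gap 8 absorbs the shifts, which lie between 1 and 5. *)
Lemma center_base_lt (i j : 'I_k) : i < j -> center_base i + 8 <= center_base j.
Proof.
move=> ij; apply: (@leq_trans (\sum_(l < (n i)./2) (8 * level n i l.*2 + 5 + 8))).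
  by rewrite big_split leq_add2l sum_nat_const card_ord leq_pmull ?half_gt0.
apply: (leq_sum_ord (F := fun l => 8 * level n i l.*2 + 5 + 8)
    (F' := fun l => 8 * level n j l.*2 + 5)) => [|l _].
  exact/half_mono/ltnW.
by have := level_double_lt l ij; lia.
Qed.

Lemma leaf_part_lt (i j : 'I_k) : 0 < c -> i < j -> leaf_part i < leaf_part j.
Proof.
move=> hc ij; rewrite -addn1 /leaf_part.
apply: (@leq_trans (\sum_(l < (n i)./2)
  (8 * L + 2 * (c + d) * (level n i l.*2).*2 + (2 * (c + d)).+1 + 1))).
  by rewrite [X in _ <= X]big_split leq_add2l sum_nat_const card_ord leq_pmull ?half_gt0.
pose F i' l := 8 * L + 2 * (c + d) * (level n i' l.*2).*2 + (2 * (c + d)).+1.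
apply: (leq_sum_ord (F := fun l => F i l + 1) (F' := F j)) => [|l _].
  exact/half_mono/ltnW.
rewrite /F; have := level_double_lt l ij; move: (L) (level _ _ _) (level _ _ _); nia.
Qed.

Lemma center_lt_leaf y i : center_part y i < leaf_part i.
Proof.
(* Each level gains at least 4, since a level number is below [L]; the perturbation adds at most 5 -
   3 = 2. *)
have : center_base i + 3 * (n i)./2 + (n i)./2 <= leaf_part i.
  rewrite -addnA -mulSnr -[(n i)./2 in X in _ + X]card_ord mulnC -sum_nat_const.
  rewrite -big_split; apply: leq_sum => l _ /=.
  have l_lt : l.*2 < n i by have := ltn_ord l; lia.
  have := level_lt n_even (Ordinal l_lt) => /=.
  by move: (L) (level _ _ _); nia.
have := half_gt0 i; have := shift_mem k i; rewrite !inE /center_part /center_shift.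
by case: y; lia.
Qed.

(** Different parts are separated by the gap 8; within one part, the two centres differ because a
    shift is never 3. *)
Lemma center_part_inj y y' i j :
  center_part y i = center_part y' j -> i = j /\ y = y'.
Proof.
have := shift_mem k i; have := shift_mem k j.
rewrite !inE /center_part /center_shift => shift_j shift_i.
case: (ltngtP i j) => [/center_base_lt|/center_base_lt|/val_inj eq_ij].
- by case: y y' => [] []; lia.
- by case: y y' => [] []; lia.
have : 5 <= center_base i.
  rewrite /center_base; move: (half_gt0 i); case: (_./2) => // h _.
  by rewrite big_ord_recl; lia.
by move=> base_ge5; rewrite -eq_ij => eq_part; split=> //; case: y y' eq_part => [] []; lia.
Qed.

Lemma sum_center_part y : 2 <= k -> \sum_i center_part y i = \sum_i center_base i.
Proof.
move=> hk.
have sum_center_shift : \sum_i center_shift y i = 3 * k.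
  case: y; last exact: sum_shift.
  apply: (@addIn (3 * k)); rewrite -[in LHS](sum_shift hk) -big_split /=.
  rewrite (eq_bigr (fun=> 6)) => [|i _].
    by rewrite sum_nat_const card_ord; lia.
  by have := shift_mem k i; rewrite !inE; lia.
have sum3 : \sum_(i < k) 3 = 3 * k by rewrite sum_nat_const card_ord mulnC.
(* Adding 3 in every part undoes the natural-number subtraction in [center_part]. *)
apply: (@addIn (3 * k)); rewrite -{2}sum_center_shift -{1}sum3 -!big_split /=.
apply: eq_bigr => i _; rewrite subnK //.
by rewrite /center_base; move: (half_gt0 i); case: (_./2) => // h _;
  rewrite big_ord_recl; lia.
Qed.

Lemma exists_labeling : 0 < c -> 0 < d -> 2 <= k ->
  exists2 f : GH -> 'I_#|GH|, local_distance_antimagic f & num_weights f <= 3 * k.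
Proof.
move=> hc hd hk.
suff [] : local_distance_antimagic labeling /\ num_weights labeling <= 3 * k.
  by exists labeling.
apply: (local_distance_antimagic_double_star n_pos hc hd labeling_inj
  (part_sum_center false) (part_sum_center true) part_sum_leaf).
- by move=> i j /center_part_inj[].
- by move=> i j /center_part_inj[].
- move=> i j eq_ij; apply: val_inj.
  by case: (ltngtP i j) => // /(leaf_part_lt hc); rewrite eq_ij ltnn.
- by move=> i j /center_part_inj[].
- by rewrite !sum_center_part.
apply: (@leq_trans (\sum_i (center_part false i + 1))).
  by rewrite big_split sum_nat_const card_ord -addn1 leq_add2l muln1 ltnW.
by apply: leq_sum => i _; rewrite addn1 center_lt_leaf.
Qed.

End Labeling.

Theorem theorem6p3 (c d k : nat) (n : 'I_k -> nat)
  (hc : 0 < c) (hd : 0 < d) (hk : 2 <= k)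
  (n_mono : forall i j : 'I_k, i <= j -> n i <= n j)
  (n_even : forall i : 'I_k, ~~ odd (n i))
  (n_pos : forall i : 'I_k, 0 < n i) :
  exists m : nat,
    is_chi_ld (lex_product (double_star c d) (complete_multipartite n)) m /\
    2 * k < m <= 3 * k.

Proof.
have [f f_ok f_le] := exists_labeling n_even n_pos n_mono hc hd hk.
have [m chi_m m_le] := is_chi_ld_exists f_ok.
exists m; split=> //; rewrite (leq_trans m_le f_le) andbT.
by case: chi_m => [[g g_ok <-] _]; apply: num_weights_lower.
Qed.
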